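(* Let $\beta>\beta_c$ and let $(k_N)$ be a sequence of positive integers with $k_N\uparrow\infty$, $k_N/N\uparrow\infty$ and $(\log k_N)/N\downarrow0$ as $N\to\infty$, $k_N\le 2^N$. Let $(U_1,\ldots,U_{2^N})$ be i.i.d. uniform random variables on $(0,1)$ with order statistics $U_{1,2^N}\le\cdots\le U_{2^N,2^N}$ and, independently, let $((\sigma)_1,\ldots,(\sigma)_{k_N})$ be an ordered sequence of $k_N$ spin configurations chosen one after the other, uniformly and without replacement, in $\{-1,+1\}^N$. Then the random measure on $\{-1,+1\}^N$ defined by $$\tilde\mu^{(1)}_{k_N,\beta}(\Psi):=\frac{\Psi((\sigma)_1)+\sum_{k=2}^{k_N}\Psi((\sigma)_k)\exp\left(-\frac{\beta}{\beta_c}\sqrt{2\log 2^N}\,\big(G(U_{1,2^N})-G(U_{k,2^N})\big)\right)}{1+\sum_{k=2}^{k_N}\exp\left(-\frac{\beta}{\beta_c}\sqrt{2\log 2^N}\,\big(G(U_{1,2^N})-G(U_{k,2^N})\big)\right)}$$ has the same distribution as the random measure $\mu^{(1)}_{k_N,\beta}$.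
   Context: $\beta_c:=\sqrt{2\log 2}$; $\Phi$ is the standard Gaussian distribution function and $G:(0,1)\to\mathbb R$ is defined by $1-\Phi(G(u))=u$. Let $\{(s)_i:1\le i\le 2^N\}$ be a fixed enumeration of $\{-1,+1\}^N$, let $(X_i)_{1\le i\le 2^N}$ be i.i.d. standard Gaussian random variables, $X_i$ attached to $(s)_i$, with order statistics $X_{1,2^N}\le\cdots\le X_{2^N,2^N}$, and let $(\tilde\sigma)_j$ be the (a.s. unique) configuration $(s)_i$ with $X_i=X_{j,2^N}$. The random probability measure $\mu^{(1)}_{k_N,\beta}$ on $\{-1,+1\}^N$ is defined, for $\Psi:\{-1,+1\}^N\to\mathbb R$, by $$\mu^{(1)}_{k_N,\beta}(\Psi):=\frac{\sum_{k=1}^{k_N}\Psi((\tilde\sigma)_k)\exp\left(-\frac{\beta}{\beta_c}\sqrt{2\log 2^N}(X_{k,2^N}-X_{1,2^N})\right)}{\sum_{k=1}^{k_N}\exp\left(-\frac{\beta}{\beta_c}\sqrt{2\log 2^N}(X_{k,2^N}-X_{1,2^N})\right)}.$$ *)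

(* Defs.v *)
From HB Require Import structures.
From mathcomp Require Import all_boot all_order all_algebra.
From mathcomp Require Import all_classical all_reals all_analysis.

Set Implicit Arguments.
Unset Strict Implicit.
Unset Printing Implicit Defensive.

Import Order.TTheory GRing.Theory Num.Theory.
Import numFieldNormedType.Exports.

Local Open Scope classical_set_scope.
Local Open Scope ring_scope.

Definition spin : finType := seq_sub [:: (-1)%Z; 1%Z].

Definition spin_up : spin := @SeqSub _ [:: (-1)%Z; 1%Z] 1%Z isT.

Definition config (N : nat) : Type := {ffun 'I_N -> spin}.

HB.instance Definition _ N := Finite.on (config N).
HB.instance Definition _ N := isPointed.Build (config N) [ffun=> spin_up].
HB.instance Definition _ N := @isMeasurable.Build default_measure_display
  (config N) discrete_measurable discrete_measurable0
  discrete_measurableC discrete_measurableU.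

Definition beta_c (R : realType) : R := Num.sqrt (2 * ln 2).

(* Distribution function of N(0, 1). *)
Definition Phi (R : realType) (x : R) : R := fine (normal_prob 0 1 `]-oo, x]).

(* For 0 < u < 1 the set below is a singleton; elsewhere it is empty and
   [G u] takes the default value 0. *)
Definition G (R : realType) (u : R) : R := xget 0 [set x | 1 - Phi x = u].

(* Ranks are 1-based, and all values of [x] are counted with multiplicity:
   [ordstat x 1 <= ... <= ordstat x n] for [x : 'I_n -> R]. *)
Definition ordstat (R : realType) (n : nat) (x : 'I_n -> R) (k : nat) : R :=
  nth 0 (sort <=%O (codom x)) k.-1.

(* The configuration [s i] carrying the value of rank [k]; on a tie (an event
   of probability 0 for Gaussian data) one of the candidates is picked. *)
Definition config_at_rank (R : realType) (N n : nat) (s : 'I_n -> config N)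
    (x : 'I_n -> R) (k : nat) : config N :=
  if [pick i | x i == ordstat x k] is Some i then s i else point.

Definition gibbs_weight (R : realType) (beta : R) (N : nat) (h : R) : R :=
  expR (- (beta / beta_c R * Num.sqrt (2 * ln ((2 ^ N)%N%:R)) * h)).

(* The two random measures are first given, as functions of the data, by their
   values on test functions [Psi]. *)
Definition mu_functional (R : realType) (beta : R) (N K : nat)
    (s : 'I_(2 ^ N) -> config N) (x : 'I_(2 ^ N) -> R)
    (Psi : config N -> R) : R :=
  (\sum_(1 <= k < K.+1)
      Psi (config_at_rank s x k)
      * gibbs_weight beta N (ordstat x k - ordstat x 1))
  / (\sum_(1 <= k < K.+1) gibbs_weight beta N (ordstat x k - ordstat x 1)).

Definition mu_tilde_functional (R : realType) (beta : R) (N K : nat)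
    (sigma : K.-tuple (config N)) (u : 'I_(2 ^ N) -> R)
    (Psi : config N -> R) : R :=
  let sigma_ k := nth point sigma k.-1 in
  (Psi (sigma_ 1%N)
   + \sum_(2 <= k < K.+1)
       Psi (sigma_ k)
       * gibbs_weight beta N (G (ordstat u 1) - G (ordstat u k)))
  / (1 + \sum_(2 <= k < K.+1)
       gibbs_weight beta N (G (ordstat u 1) - G (ordstat u k))).

Definition represents (R : realType) (N : nat) (L : (config N -> R) -> R)
    (m : pprobability (config N) R) : Prop :=
  forall Psi : config N -> R, (\int[m]_x (Psi x)%:E = (L Psi)%:E)%E.

(* The probability measure on configurations whose integrals are given by [L];
   see [represents_uniq], [mu_spec] and [mu_tilde_spec] below. *)
Definition measure_of (R : realType) (N : nat) (L : (config N -> R) -> R) :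
    pprobability (config N) R :=
  xget point (represents L).

Definition mu (R : realType) (beta : R) (N K : nat)
    (s : 'I_(2 ^ N) -> config N) (x : 'I_(2 ^ N) -> R) :
    pprobability (config N) R :=
  measure_of (mu_functional beta K s x).

Definition mu_tilde (R : realType) (beta : R) (N K : nat)
    (sigma : K.-tuple (config N)) (u : 'I_(2 ^ N) -> R) :
    pprobability (config N) R :=
  measure_of (mu_tilde_functional beta sigma u).

Section probability_notions.
Context {R : realType} {d : measure_display} {T : measurableType d}.
Variable P : probability T R.
Local Open Scope ereal_scope.

Definition has_law d' (T' : measurableType d') (X : T -> T')
    (m : set T' -> \bar R) : Prop :=
  forall A, measurable A -> P (X @^-1` A) = m A.

Definition mutually_independent d' (T' : measurableType d') (n : nat)
    (X : 'I_n -> T -> T') : Prop :=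
  forall (J : {set 'I_n}) (A : 'I_n -> set T'),
    (forall i, measurable (A i)) ->
    P [set w | forall i, i \in J -> A i (X i w)]
    = \prod_(i in J) P (X i @^-1` A i).

Definition independent d1 d2 (T1 : measurableType d1) (T2 : measurableType d2)
    (X : T -> T1) (Y : T -> T2) : Prop :=
  forall A B, measurable A -> measurable B ->
    P (X @^-1` A `&` Y @^-1` B) = P (X @^-1` A) * P (Y @^-1` B).

(* [sigma] is a sequence of [n] successive uniform draws without replacement:
   given that the first draws are [s], the next one is uniform on the elements
   not in [s]. *)
Definition draws_without_replacement (C : finType) (n : nat)
    (sigma : T -> n.-tuple C) : Prop :=
  forall (s : seq C) (t : C), (size s < n)%N ->
    P [set w | take (size s).+1 (sigma w) = rcons s t]
    = P [set w | take (size s) (sigma w) = s]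
      * (if t \in s then 0%R else (#|C| - size s)%:R^-1)%:E.

End probability_notions.

(* The laws are only compared on measurable sets: outside the sigma-algebra the
   value of a [probability] is unconstrained. *)
Definition same_law (R : realType) (d1 d2 d' : measure_display)
    (T1 : measurableType d1) (T2 : measurableType d2) (T' : measurableType d')
    (P1 : probability T1 R) (P2 : probability T2 R)
    (X : T1 -> T') (Y : T2 -> T') : Prop :=
  [/\ measurable_fun setT X, measurable_fun setT Y &
      forall A, measurable A -> P1 (X @^-1` A) = P2 (Y @^-1` A)].

(* Index 0 is excluded: these predicates are applied to quotients by N. *)
Definition increases_to_pinfty (R : realType) (u : nat -> R) : Prop :=
  (forall m n, (0 < m <= n)%N -> u m <= u n) /\ u @ \oo --> +oo.

Definition decreases_to_0 (R : realType) (u : nat -> R) : Prop :=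
  (forall m n, (0 < m <= n)%N -> u n <= u m) /\ u @ \oo --> (0 : R).

Lemma represents_uniq (R : realType) (N : nat) (L : (config N -> R) -> R)
    (m1 m2 : pprobability (config N) R) :
  represents L m1 -> represents L m2 -> forall A, m1 A = m2 A.
Proof.
move=> h1 h2 A.
have mA : measurable A by [].
have E (m : pprobability (config N) R) : (\int[m]_x (\1_A x)%:E = m A)%E.
  by rewrite integral_indic // setIT.
by rewrite -E -[RHS]E (h1 \1_A) (h2 \1_A).
Qed.

Lemma integral_config (R : realType) (N : nat) (m : pprobability (config N) R)
    (Psi : config N -> R) :
  (\int[m]_x (Psi x)%:E = \sum_(c : config N) (Psi c)%:E * m [set c])%E.
Proof.
have E x : ((Psi x)%:E = \sum_(c : config N) (Psi c)%:E * (\1_[set c] x)%:E)%E.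
  rewrite (bigD1 x) //= big1 ?adde0.
    by rewrite indicE mem_set// mule1.
  move=> c cx; rewrite indicE memNset ?mule0 //= => xc.
  by rewrite xc eqxx in cx.
have mc (c : config N) : measurable [set c] by [].
under eq_integral do rewrite E.
rewrite integral_sum //; last first.
  by move=> c; apply: integrableZl => //; exact: integrable_indic.
apply: eq_bigr => c _; rewrite integralZl //; last exact: integrable_indic.
by rewrite integral_indic // setIT.
Qed.

Lemma represents_weighted (R : realType) (N n : nat) (c : nat -> config N)
    (w : nat -> R) : (0 < n)%N -> (forall k, 0 < w k) ->
  exists m : pprobability (config N) R,
    represents (fun Psi => (\sum_(1 <= k < n.+1) Psi (c k) * w k)
                           / (\sum_(1 <= k < n.+1) w k)) m.
Proof.
move=> n0 w0.
pose W := \sum_(1 <= k < n.+1) w k.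
have W0 : 0 < W.
  rewrite /W big_nat_recl //= ltr_pwDl //; apply: sumr_ge0 => i _; exact: ltW.
pose wn k : {nonneg R} := NngNum (ltW (w0 k)).
pose nu := msum (fun k => mscale (wn k.+1) (@dirac _ (config N) (c k.+1) R)) n.
have nuE A : nu A = (\sum_(1 <= k < n.+1) w k * \1_A (c k))%:E.
  rewrite /nu /msum big_add1 /= -sumEFin big_mkord.
  by apply: eq_bigr => k _; rewrite /mscale /= diracE EFinM indicE.
have nuT : nu setT = W%:E.
  by rewrite nuE; congr EFin; apply: eq_bigr => k _; rewrite indicT mulr1.
exists (mnormalize nu point : probability (config N) R) => Psi.
rewrite integral_config.
have mE (A : set (config N)) : mnormalize nu point A
    = ((\sum_(1 <= k < n.+1) w k * \1_A (c k)) / W)%:E.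
  rewrite /mnormalize /= -/nu nuT.
  by rewrite eqe gt_eqF //= EFinM -nuE.
rewrite (eq_bigr (fun x => (Psi x *
    ((\sum_(1 <= k < n.+1) w k * \1_[set x] (c k)) / W))%:E)); last first.
  by move=> x _; rewrite EFinM; congr (_ * _)%E; exact: mE.
rewrite sumEFin; congr EFin.
under eq_bigr do rewrite mulrA mulr_sumr.
rewrite -mulr_suml; congr (_ / _).
rewrite exchange_big /=; apply: eq_bigr => k _.
rewrite (bigD1 (c k)) //= big1 ?addr0.
  by rewrite indicE mem_set // mulr1.
move=> x xc; rewrite indicE memNset ?mulr0 //= => cx.
by rewrite cx eqxx in xc.
Qed.

Lemma mu_spec (R : realType) (beta : R) (N K : nat)
    (s : 'I_(2 ^ N) -> config N) (x : 'I_(2 ^ N) -> R) : (0 < K)%N ->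
  represents (mu_functional beta K s x) (mu beta K s x).
Proof.
move=> K0; apply: xgetPex; apply: represents_weighted => // k.
exact: expR_gt0.
Qed.

Lemma mu_tilde_spec (R : realType) (beta : R) (N K : nat)
    (sigma : K.-tuple (config N)) (u : 'I_(2 ^ N) -> R) : (0 < K)%N ->
  represents (mu_tilde_functional beta sigma u) (mu_tilde beta sigma u).
Proof.
move=> K0; apply: xgetPex.
pose w k := gibbs_weight beta N (G (ordstat u 1) - G (ordstat u k)).
have w1 : w 1%N = 1 by rewrite /w /gibbs_weight subrr mulr0 oppr0 expR0.
have [|m mP] := @represents_weighted R N K (fun k => nth point sigma k.-1) w K0.
  by move=> k; exact: expR_gt0.
exists m => Psi; rewrite mP /mu_tilde_functional.
by rewrite !(@big_ltn _ _ _ 1 K.+1) // w1 mulr1.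
Qed.

(* Main.v *)
From HB Require Import structures.
Require Import Defs.
From mathcomp Require Import all_boot all_order all_algebra fingroup perm action.
From mathcomp Require Import primitive_action alt.
From mathcomp Require Import all_classical all_reals all_analysis measurable_realfun.
Set Implicit Arguments.
Unset Strict Implicit.
Unset Printing Implicit Defensive.
Import Order.TTheory GRing.Theory Num.Theory.
Import numFieldNormedType.Exports.
Local Open Scope classical_set_scope.
Local Open Scope ring_scope.

(** Both random measures are one and the same function [weighted_measure] of two
    arguments: a [K]-tuple of configurations and the increasing list of order
    statistics ([mu_weighted], [mu_tilde_weighted]).  So it is enough to compare
    the joint laws of these two arguments.

    Order statistics.  By symmetry of the Gaussian law, [- G] is the quantile
    function of N(0, 1) ([Phi_oppG]); hence the [- G (U_i)] are i.i.d. standard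
    Gaussian like the [X_i], and the two vectors have the same joint law
    ([eq_law_independent]).  Since [- G] is increasing on (0, 1), it commutes
    with taking order statistics ([ordstat_oppG]), up to the null event that
    some [U_i] lies outside (0, 1).

    Configurations.  An i.i.d. vector is exchangeable, and the Gaussian vector
    has almost surely no ties, which is transferred from the uniform vector
    ([uniform_tie], [normal_score_uniq]).  Off the ties, permuting the
    coordinates permutes the configurations carrying the [K] smallest values
    and leaves the order statistics unchanged ([leading_configs_perm]); as the
    symmetric group acts transitively on [K]-tuples of distinct configurations,
    these configurations are independent of the order statistics and uniform
    among such tuples ([leading_event_prob]).  This is exactly the law of [K]
    draws without replacement ([draws_prob]), independent of the [U_i].

    The theorem follows by summing over the finitely many values of the tuple of
    configurations.  Measurability is handled in the same way: the sample space
    is cut into finitely many events, one for each tuple and, for the order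
    statistics, one for each outcome of the pairwise comparisons
    ([measurable_fun_piecewise]). *)

(** * The Gaussian distribution function and its quantile *)

Section gaussian_quantile.
Context {R : realType}.
Local Notation mu := (@lebesgue_measure R).
Local Notation gauss := (@normal_prob R 0 1).

Lemma Phi_derivable (x : R) :
  derivable (@Phi R) x 1 /\ (@Phi R)^`()%classic x = normal_pdf 0 1 x.
Proof.
apply: (@continuous_FTC1 R (normal_pdf 0 1) -oo%O x (x + 1)).
- by rewrite ltrDl.
- by apply: (integrableS _ _ (subsetT _)) => //; exact: integrable_normal_pdf.
- exact: ltNyr.
- exact: continuous_normal_pdf.
Qed.

Lemma Phi_continuous : continuous (@Phi R).
Proof.
move=> x; apply/differentiable_continuous/derivable1_diffP.
exact: (Phi_derivable x).1.
Qed.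

Lemma Phi_incr : {mono (@Phi R) : x y / x <= y}.
Proof.
apply: le_mono => x y xy.
apply: (@gtr0_derive1_incr R (@Phi R) x y) => //.
- by move=> z _; exact: (Phi_derivable z).1.
- move=> z _; rewrite (Phi_derivable z).2 normal_pdfE ?oner_eq0//.
  by rewrite mulr_gt0 ?expR_gt0// normal_peak_gt0 ?oner_eq0.
- exact/continuous_subspaceT/Phi_continuous.
Qed.

Lemma PhiE (x : R) : (Phi x)%:E = gauss `]-oo, x].
Proof. by rewrite /Phi fineK ?fin_num_measure. Qed.

(** The density is even and Lebesgue measure is invariant under [-%R]. *)
Lemma gaussN (A : set R) : measurable A -> gauss (-%R @^-1` A) = gauss A.
Proof.
move=> mA; rewrite /normal_prob.
have mpdf : measurable_fun [set: R] (fun x : R => (normal_pdf 0 1 x)%:E).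
  by apply/measurable_EFinP; exact: measurable_normal_pdf.
transitivity (\int[mu]_(x in (-%R : _ -> measurableTypeR R) @^-1` A)
    ((fun y : R => (normal_pdf 0 1 y)%:E) \o (-%R : _ -> measurableTypeR R)) x)%E.
  apply: eq_integral => x _ /=; congr (_%:E).
  by rewrite !normal_pdfE ?oner_eq0// /normal_fun !subr0 sqrrN.
rewrite -ge0_integral_pushforward//=.
- by apply: eq_measure_integral => //= B mB BA; exact: lebesgue_measureN.
- exact: measurable_funS mpdf.
- by move=> y _; rewrite lee_fin normal_pdf_ge0.
Qed.

Lemma gauss_set1 (x : R) : gauss [set x] = 0%E.
Proof.
have /null_content_dominatesP := @normal_prob_dominates R 0 1.
by apply => //; exact: lebesgue_measure_set1.
Qed.

Lemma PhiN (x : R) : 1 - Phi x = Phi (- x).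
Proof.
apply: EFin_inj; rewrite EFinB !PhiE -[1%:E](@probability_setT _ _ _ gauss).
rewrite -(setvU `]-oo, x]%classic) measureU ?setICl//; last exact: measurableC.
rewrite addeK ?fin_num_measure// setCitvl.
have -> : `]-oo, - x]%classic = -%R @^-1` `[x, +oo[%classic.
  by rewrite opp_preimage_itvbndy.
rewrite gaussN// -(@setU1itv _ _ _ x false)// setUC measureU0//.
exact: gauss_set1.
Qed.

Lemma Phi_surj (u : R) : 0 < u < 1 -> exists x, Phi x = u.
Proof.
move=> /andP[u0 u1].
(* [cdf] is defined for random variables: [Phi] is the one of the identity. *)
pose idR : measurableTypeR R -> R := idfun.
pose midR := isMeasurableFun.Build _ _ _ _ idR (@measurable_id _ _ setT).
pose X : {RV gauss >-> R} := HB.pack idR midR.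
have PhiE' : @Phi R = fine \o cdf X.
  by apply/funext => x; rewrite /Phi /= /cdf /distribution /pushforward.
have [a au] : exists a, Phi a < u.
  have /fine_cvg/= := @cvg_cdfNy0 _ _ _ _ X.
  rewrite -/(fine \o cdf X) -PhiE' => /cvgr_lt/(_ u u0)/filter_ex[a ?].
  by exists a.
have [b bu] : exists b, u < Phi b.
  have /fine_cvg/= := @cvg_cdfy1 _ _ _ _ X.
  rewrite -/(fine \o cdf X) -PhiE' => /cvgr_gt/(_ u u1)/filter_ex[b ?].
  by exists b.
have ab : a <= b by rewrite -Phi_incr (ltW (lt_trans au bu)).
have [||c _ <-] := @IVT R (@Phi R) a b u ab.
- exact/continuous_subspaceT/Phi_continuous.
- by rewrite ge_min le_max (ltW au) (ltW bu) orbT.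
- by exists c.
Qed.

(** [- G] is the quantile function of the Gaussian law: [1 - Phi (G u) = u] and
    [1 - Phi x = Phi (- x)]. *)
Lemma Phi_oppG (u : R) : 0 < u < 1 -> Phi (- G u) = u.
Proof.
move=> u01; rewrite -PhiN.
have [x xu] := Phi_surj u01.
suff : [set x | 1 - Phi x = u] (G u) by [].
apply: (@xgetPex _ _ [set x | 1 - Phi x = u]).
by exists (- x) => /=; rewrite PhiN opprK.
Qed.

Lemma Phi_gt0 (x : R) : 0 < Phi x.
Proof.
apply: (@le_lt_trans _ _ (Phi (x - 1))); first by rewrite fine_ge0.
by rewrite (leW_mono Phi_incr) gtrBl.
Qed.

Lemma Phi_lt1 (x : R) : Phi x < 1.
Proof. by rewrite -subr_gt0 PhiN Phi_gt0. Qed.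

Lemma oppG_le (u x : R) : 0 < u < 1 -> (- G u <= x) = (u <= Phi x).
Proof. by move=> u01; rewrite -[X in _ = (X <= _)](Phi_oppG u01) Phi_incr. Qed.

Lemma G_outside (u : R) : ~~ (0 < u < 1) -> G u = 0.
Proof.
move=> u01; rewrite /G xgetPN// => x /= xu; move/negP: u01; apply.
by rewrite -xu PhiN Phi_gt0 Phi_lt1.
Qed.

(** [G] is monotone only inside (0, 1), where [oppG_le] describes its level sets;
    outside it has the default value 0. *)
Lemma measurable_G : measurable_fun setT (@G R).
Proof.
rewrite (_ : @G R = (fun u => if (0 < u) && (u < 1) then G u else 0)); last first.
  by apply/funext => u; case: ifPn => // /G_outside.
apply: measurable_fun_if => //.
- by apply: measurable_and; exact: measurable_fun_ltr.
- rewrite setTI -[X in measurable_fun X](_ : `]0, 1[%classic = _); last first.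
    by apply/seteqP; split => u /=; rewrite in_itv.
  apply: (measurability (@RGenCInfty.G R)) => [|/= _ [_] [r] -> <-].
    exact: RGenCInfty.measurableE.
  rewrite [X in measurable X](_ : _ =
      `]0, 1[%classic `&` `]-oo, Phi (- r)]%classic).
    exact: measurableI.
  apply/seteqP; split => u /=; rewrite !in_itv/= ?andbT => -[u01 H]; split => //.
    by rewrite -oppG_le// lerN2.
  by rewrite -lerN2 oppG_le.
Qed.

Lemma uniform_probE (A : set R) : measurable A ->
  uniform_prob (@ltr01 R) A = mu (A `&` `[0, 1]).
Proof.
move=> mA; rewrite /uniform_prob integral_uniform_pdf.
rewrite (eq_integral (fun=> 1%:E)).
  by rewrite integral_cst ?mul1e//; exact: measurableI.
move=> x; rewrite inE/= => -[_]; rewrite in_itv/= => x01.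
by rewrite /uniform_pdf x01 subr0 invr1.
Qed.

Lemma uniform_cdf (t : R) : 0 <= t <= 1 ->
  uniform_prob (@ltr01 R) `]-oo, t] = t%:E.
Proof.
move=> /andP[t0 t1]; rewrite uniform_probE//.
rewrite (_ : _ `&` _ = `[0, t]%classic); last first.
  apply/seteqP; split => x /=; rewrite !in_itv/=; first by move=> [-> /andP[->]].
  by move=> /andP[-> xt]; rewrite xt (le_trans xt).
rewrite lebesgue_measure_itv/= lte_fin oppr0 adde0.
by case: ltgtP t0 => // <-.
Qed.

Lemma uniform_outside : uniform_prob (@ltr01 R) (~` `]0, 1[%classic) = 0%E.
Proof.
rewrite probability_setC//= uniform_probE// setIidl; last first.
  exact: subset_itv_oo_cc.
by rewrite lebesgue_measure_itv/= lte_fin ltr01 oppr0 adde0 subee.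
Qed.

End gaussian_quantile.

(** * Joint laws of independent variables, and ties *)

(** The half-lines form a pi-system generating the Borel sets. *)
Lemma eq_prob_cdf (R : realType) (Q1 Q2 : probability R R) :
  (forall x : R, Q1 `]-oo, x]%classic = Q2 `]-oo, x]%classic) ->
  forall A, measurable A -> Q1 A = Q2 A.
Proof.
move=> Q12 A mA.
pose G := [set `]-oo, x]%classic | x in [set: R]].
apply: (measure_unique G (fun n => `]-oo, n%:R]%classic)) => //.
- rewrite [LHS](RGenOInfty.measurableE R).
  apply/seteqP; split; apply: smallest_sub; [exact: smallest_sigma_algebra| |
    exact: (@sigma_algebra_measurable _ (g_sigma_algebraType _)) |].
  + move=> _ [x ->]; rewrite -setCitvl.
    apply: (@measurableC _ (g_sigma_algebraType G)).
    by apply: sub_sigma_algebra; exists x.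
  + move=> _ [x _ <-]; rewrite -setCitvr.
    apply: (@measurableC _ (g_sigma_algebraType (@RGenOInfty.G R))).
    by apply: sub_sigma_algebra; exists x.
- move=> _ _ [x _ <-] [y _ <-]; exists (Order.min x y) => //.
  by apply/seteqP; split => z /=; rewrite !in_itv/= le_min => /andP.
- by move=> n; exists n%:R.
- apply/seteqP; split => // x _; exists (Num.truncn x).+1 => //=.
  by rewrite in_itv/= ltW// truncnS_gt.
- by move=> _ [x _ <-]; exact: Q12.
- by move=> k; rewrite (le_lt_trans (probability_le1 _ _))// ltry.
Qed.

Section random_vector.
Context d d' (T : measurableType d) (T' : measurableType d') (n : nat).

Definition random_vector (X : 'I_n -> {mfun T >-> T'}) (w : T) : n.-tuple T' :=
  [tuple X i w | i < n].

Lemma tnth_random_vector X w : tnth (random_vector X w) = fun i => X i w.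
Proof. by apply/funext => i; rewrite tnth_mktuple. Qed.

Variable X : 'I_n -> {mfun T >-> T'}.

Lemma measurable_random_vector : measurable_fun setT (random_vector X).
Proof.
apply/measurable_fun_tnthP => i.
rewrite (_ : _ \o _ = X i)//.
by apply/funext => w /=; rewrite tnth_mktuple.
Qed.

HB.instance Definition _ := isMeasurableFun.Build _ _ _ _ (random_vector X)
  measurable_random_vector.

End random_vector.

Lemma measurable_forall d (T : measurableType d) (I : finType) (F : I -> set T) :
  (forall i, measurable (F i)) -> measurable [set w | forall i, F i w].
Proof.
move=> mF; rewrite (_ : mkset _ = \big[setI/setT]_(i : I) F i).
  exact: bigsetI_measurable.
rewrite -bigcap_seq.
apply/seteqP; split => w /= Fw i; first by move=> _; exact: Fw.
by apply: Fw; rewrite /= mem_index_enum.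
Qed.

Section tuple_law.
Context d (T : measurableType d) (n : nat) (R : realType).

(** The rectangles form a pi-system generating the product sigma-algebra. *)
Lemma eq_prob_tuple (Q1 Q2 : probability (n.-tuple T) R) :
  (forall A : 'I_n -> set T, (forall i, measurable (A i)) ->
    Q1 [set t | forall i, A i (tnth t i)] = Q2 [set t | forall i, A i (tnth t i)]) ->
  forall B, measurable B -> Q1 B = Q2 B.
Proof.
move=> Q12 B mB.
pose rect (A : 'I_n -> set T) := [set t : n.-tuple T | forall i, A i (tnth t i)].
pose G := [set B | exists2 A, (forall i, measurable (A i)) & B = rect A].
have mrect A : (forall i, measurable (A i)) -> measurable (rect A).
  move=> mA; apply: measurable_forall => i.
  by rewrite -[X in measurable X]setTI; exact: measurable_tnth.
apply: (measure_unique G (fun=> setT)) => //.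
- apply/seteqP; split.
  + apply: smallest_sub; first exact: smallest_sigma_algebra.
    rewrite -bigcup_seq/= => C [i _ [A mA <-]].
    apply: sub_sigma_algebra; exists (fun j => if j == i then A else setT).
      by move=> j; case: ifP.
    rewrite setTI; apply/seteqP; split => t /=.
      by move=> At j; case: eqP => // ->.
    by move=> /(_ i); rewrite eqxx.
  + apply: smallest_sub; first exact: sigma_algebra_measurable.
    by move=> _ [A mA ->]; exact: mrect.
- move=> _ _ [A mA ->] [A' mA' ->]; exists (fun i => A i `&` A' i).
    by move=> i; exact: measurableI.
  apply/seteqP; split => t /=; first by move=> [At A't] i; split.
  by move=> At; split => i; case: (At i).
- by move=> _; exists (fun=> setT) => //; apply/seteqP; split.
- by apply/seteqP; split => // t _; exists 0%N.
- by move=> _ [A mA ->]; exact: Q12.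
- by move=> k; rewrite (le_lt_trans (probability_le1 _ _))// ltry.
Qed.

End tuple_law.

Lemma independent_rect d (T : measurableType d) d' (T' : measurableType d')
    (R : realType) (P : probability T R) n (X : 'I_n -> {mfun T >-> T'})
    (A : 'I_n -> set T') :
  mutually_independent P X -> (forall i, measurable (A i)) ->
  distribution P (random_vector X) [set t | forall i, A i (tnth t i)]
  = (\prod_(i < n) P (X i @^-1` A i))%E.
Proof.
move=> Xi mA; have := Xi finset.setT A mA.
under [X in _ = X]eq_bigl do rewrite finset.in_setT.
move=> <-; rewrite /distribution /pushforward; congr (P _).
apply/seteqP; split => w /=; rewrite tnth_random_vector => Aw i; first by move=> _.
by apply: Aw; rewrite finset.in_setT.
Qed.

Lemma eq_law_independent d1 (T1 : measurableType d1) d2 (T2 : measurableType d2)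
    d' (T' : measurableType d') (R : realType)
    (P1 : probability T1 R) (P2 : probability T2 R) n
    (X : 'I_n -> {mfun T1 >-> T'}) (Y : 'I_n -> {mfun T2 >-> T'}) :
  mutually_independent P1 X -> mutually_independent P2 Y ->
  (forall i A, measurable A -> P1 (X i @^-1` A) = P2 (Y i @^-1` A)) ->
  forall B, measurable B ->
    distribution P1 (random_vector X) B = distribution P2 (random_vector Y) B.
Proof.
move=> Xi Yi XY; apply: eq_prob_tuple => A mA.
rewrite [LHS]independent_rect// [RHS]independent_rect//.
by apply: eq_bigr => i _; exact: XY.
Qed.

Lemma independent_perm d (T : measurableType d) d' (T' : measurableType d')
    (R : realType) (P : probability T R) n (X : 'I_n -> {mfun T >-> T'})
    (p : {perm 'I_n}) :
  mutually_independent P X -> mutually_independent P (fun i => X (p i)).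
Proof.
move=> Xi J A mA; have := Xi (p @: J) (fun i => A (p^-1%g i)) (fun i => mA _).
rewrite big_imset/=; last by move=> i j _ _; exact: perm_inj.
under [X in _ = X -> _]eq_bigr do rewrite permK.
move=> <-; congr (P _); apply/seteqP; split => w /= H i.
  by move=> /imsetP[j jJ ->]; rewrite permK; exact: H.
by move=> iJ; have := H (p i); rewrite permK; apply; exact: imset_f.
Qed.

Lemma independent_comp d (T : measurableType d) d1 (T1 : measurableType d1)
    d2 (T2 : measurableType d2)
    (R : realType) (P : probability T R) n (X : 'I_n -> T -> T1) (f : T1 -> T2) :
  measurable_fun setT f ->
  mutually_independent P X -> mutually_independent P (fun i => f \o X i).
Proof.
move=> mf Xi J A mA.
by apply: (Xi J (fun i => f @^-1` A i)) => i; rewrite -[_ @^-1` _]setTI; exact: mf.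
Qed.

Section null_sets.
Context d (T : measurableType d) (R : realType) (P : probability T R).

Lemma eq_prob_off_null (M A B : set T) :
  measurable M -> measurable A -> measurable B -> P M = 0%E ->
  (forall w, ~ M w -> A w <-> B w) -> P A = P B.
Proof.
move=> mM mA mB M0 AB; rewrite -(measureU0 mA mM M0) -(measureU0 mB mM M0).
congr (P _); apply/seteqP; split => w [Xw|]; try by right.
  by have [?|nM] := pselect (M w); [right|left; apply/AB].
by have [?|nM] := pselect (M w); [right|left; apply/AB].
Qed.

Lemma null_bigsetU (I : finType) (F : I -> set T) (D : pred I) :
  (forall i, D i -> measurable (F i)) -> (forall i, D i -> P (F i) = 0%E) ->
  measurable (\big[setU/set0]_(i | D i) F i) /\
  P (\big[setU/set0]_(i | D i) F i) = 0%E.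
Proof.
move=> mF F0; elim/big_ind : _ => //.
- by move=> A B [mA A0] [mB B0]; split; [exact: measurableU|rewrite measureU0].
- by move=> i Di; split; [exact: mF|exact: F0].
Qed.

End null_sets.

Section normal_score.
Context d (T : measurableType d) (R : realType).

(** The variable [- G V] is standard Gaussian when [V] is uniform on (0, 1). *)
Definition normal_score (V : {mfun T >-> R}) : T -> R := (fun u => - G u) \o V.

Lemma measurable_normal_score V : measurable_fun setT (normal_score V).
Proof.
apply: measurableT_comp => //; apply: measurable_funN; exact: measurable_G.
Qed.

HB.instance Definition _ V := isMeasurableFun.Build _ _ _ _ (normal_score V)
  (measurable_normal_score V).

Variables (P : probability T R) (V : {mfun T >-> R}).
Hypothesis V_unif : has_law P V (uniform_prob (@ltr01 R)).

Lemma uniform_inside_ae : P [set w | ~~ (0 < V w < 1)] = 0%E.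
Proof.
rewrite [X in P X](_ : _ = V @^-1` (~` `]0, 1[%classic)); last first.
  by apply/seteqP; split => w /=; rewrite in_itv/= => /negP.
by rewrite V_unif ?uniform_outside//; exact: measurableC.
Qed.

Lemma normal_score_law A : measurable A ->
  P (normal_score V @^-1` A) = normal_prob 0 1 A.
Proof.
move=> mA; rewrite -[LHS]/(distribution P (normal_score V) A).
(* The Gaussian law lives on [measurableTypeR R], which has the same measurable
   sets as [R] under another display; the identity transports it to [R]. *)
pose idR : measurableTypeR R -> R := idfun.
pose midR := isMeasurableFun.Build _ _ _ _ idR (@measurable_id _ _ setT).
pose idX : {mfun measurableTypeR R >-> R} := HB.pack idR midR.
rewrite -[RHS]/(distribution (normal_prob 0 1) idX A).
apply: eq_prob_cdf => // x.
rewrite -[LHS]/(P (normal_score V @^-1` `]-oo, x])).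
rewrite -[RHS]/(normal_prob 0 1 `]-oo, x]).
rewrite -PhiE -uniform_cdf; last by rewrite !ltW// (Phi_gt0, Phi_lt1).
rewrite -V_unif//; apply: (eq_prob_off_null _ _ _ uniform_inside_ae);
  try exact: measurable_funPTI.
- rewrite [X in measurable X](_ : _ = V @^-1` (~` `]0, 1[%classic)); last first.
    by apply/seteqP; split => w /=; rewrite in_itv/= => /negP.
  by apply: measurable_funPTI; exact: measurableC.
- move=> w /negP; rewrite negbK /= !in_itv/= => Vw.
  by rewrite oppG_le.
Qed.

End normal_score.

Lemma measurable_uniq (R : realType) (n : nat) :
  measurable [set t : n.-tuple R | uniq t].
Proof.
pose F (p : 'I_n * 'I_n) :=
  if p.1 == p.2 then setT else [set t : n.-tuple R | tnth t p.1 != tnth t p.2].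
rewrite [X in measurable X](_ : _ = [set t | forall p, F p t]); last first.
  apply/seteqP; split => t /=.
    move=> /tuple_uniqP ti p; rewrite /F; case: eqP => //= p12.
    by apply/eqP => /ti.
  move=> Ft; apply/tuple_uniqP => i j tij; apply/eqP.
  by have := Ft (i, j); rewrite /F /=; case: eqP => //= _; rewrite tij eqxx.
apply: measurable_forall => p; rewrite /F; case: ifP => // _.
rewrite -[X in measurable X]setTI.
exact: (measurable_neg (measurable_fun_eqr (measurable_tnth p.1) (measurable_tnth p.2))).
Qed.

Section ties.
Context d (T : measurableType d) (R : realType) (P : probability T R).
Variables (n : nat) (U : 'I_n -> {mfun T >-> R}).
Hypothesis U_indep : mutually_independent P U.
Hypothesis U_unif : forall i, has_law P (U i) (uniform_prob (@ltr01 R)).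

Lemma measurable_tie (i j : 'I_n) : measurable [set w | U i w = U j w].
Proof.
rewrite [X in measurable X](_ : _ = [set w | U i w == U j w]); last first.
  by apply/seteqP; split => w /= /eqP.
rewrite -[X in measurable X]setTI.
exact: (measurable_fun_eqr (measurable_funP (U i)) (measurable_funP (U j))).
Qed.

(** Cut [0, 1) into [m] cells of length [1 / m]: a tie puts both variables in the
    same cell, which has probability at most [m * (1 / m) ^ 2 = 1 / m]. *)
Lemma uniform_tie (i j : 'I_n) : i != j -> P [set w | U i w = U j w] = 0%E.
Proof.
move=> ij.
have mtie := measurable_tie i j.
pose cell m k : set R := `[k%:R / m%:R, k.+1%:R / m%:R[%classic.
pose F m k := U i @^-1` cell m k `&` U j @^-1` cell m k.
have mcell m k : measurable (cell m k) by exact: measurable_itv.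
have mF m k : measurable (F m k) by apply: measurableI; exact: measurable_funPTI.
have Pcell l m k : (0 < m)%N -> (P (U l @^-1` cell m k) <= (m%:R^-1)%:E)%E.
  move=> m0; rewrite U_unif// uniform_probE//.
  apply: (@le_trans _ _ (lebesgue_measure (cell m k))).
    by apply: measureIl => //; exact: mcell.
  rewrite lebesgue_measure_itv/=; case: ifP => _ //.
    by rewrite -EFinB lee_fin -mulrBl -natrB// subSnn mul1r.
have PF m k : (0 < m)%N -> (P (F m k) <= (m%:R^-1 * m%:R^-1)%:E)%E.
  move=> m0.
  have := @U_indep [set i; j]%SET (fun=> cell m k) (fun=> mcell m k).
  rewrite big_setU1 ?inE//= big_set1 => H.
  rewrite [X in P X](_ : _ =
      [set w | forall l, l \in [set i; j]%SET -> cell m k (U l w)]).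
    rewrite H// EFinM; apply: lee_pmul => //; exact: Pcell.
  apply/seteqP; split => w /=.
    by move=> [Fi Fj] l; rewrite !inE => /orP[] /eqP ->.
  by move=> Fw; split; apply: Fw; rewrite !inE eqxx ?orbT.
have bound m : (0 < m)%N -> (P [set w | U i w = U j w] <= (m%:R^-1)%:E)%E.
  move=> m0.
  have mout : measurable (U i @^-1` (~` `]0, 1[%classic)).
    by apply: measurable_funPTI; apply: measurableC; exact: measurable_itv.
  have out0 : P (U i @^-1` (~` `]0, 1[%classic)) = 0%E.
    by rewrite U_unif ?uniform_outside//; apply: measurableC; exact: measurable_itv.
  have mFs : measurable (\big[setU/set0]_(k < m) F m k).
    by apply: bigsetU_measurable => k _; exact: mF.
  rewrite -(measureU0 mtie mout out0).
  apply: (@le_trans _ _ (P ((\big[setU/set0]_(k < m) F m k) `|`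
                            U i @^-1` (~` `]0, 1[%classic)))).
    apply: le_measure; rewrite ?inE; try exact: measurableU.
    move=> w [Uij|]; last by right.
    have [/=|] := boolP (U i w \in `]0, 1[); last by move/negP; right.
    rewrite in_itv/= => /andP[U0 U1]; left.
    rewrite -bigcup_mkord /=; exists (Num.truncn (U i w * m%:R)) => /=.
      rewrite truncn_lt_nat ?mulr_ge0 ?(ltW U0)//.
      by rewrite gtr_pMl// ltr0n.
    have /andP[] := @truncn_itv R (U i w * m%:R) (mulr_ge0 (ltW U0) (ler0n _ _)).
    rewrite /F /cell /= -Uij in_itv/= ler_pdivrMr ?ltr0n// ltr_pdivlMr ?ltr0n//.
    by move=> -> ->.
  rewrite measureU0//.
  apply: (le_trans (Boole_inequality _ _)) => [k _|]; first exact: mF.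
  apply: (@le_trans _ _ (\sum_(k < m) (m%:R^-1 * m%:R^-1)%:E)%E).
    by apply: lee_sum => k _; exact: PF.
  rewrite sumEFin sumr_const card_ord lee_fin -[leLHS]mulr_natr -mulrA mulVf ?mulr1//.
  by rewrite pnatr_eq0 -lt0n.
apply/eqP; rewrite eq_le measure_ge0 andbT leNgt; apply/negP => P0.
set p := P _ in bound P0.
have pfin : p \is a fin_num by exact: fin_num_measure.
rewrite -(fineK pfin) lte_fin in P0.
have := bound (Num.truncn (fine p)^-1).+1 isT.
rewrite -(fineK pfin) lee_fin leNgt => /negP; apply.
by rewrite invf_plt ?posrE// truncnS_gt.
Qed.

(** [- G] is injective on (0, 1), so that a tie of scores is a tie of uniforms. *)
Lemma normal_score_uniq :
  P [set w | ~~ uniq (random_vector (fun i => normal_score (U i)) w)] = 0%E.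
Proof.
pose B (i : 'I_n) := U i @^-1` (~` `]0, 1[%classic).
pose E (p : 'I_n * 'I_n) := [set w | U p.1 w = U p.2 w].
have [mB B0] : measurable (\big[setU/set0]_i B i) /\ P (\big[setU/set0]_i B i) = 0%E.
  apply: null_bigsetU => i _.
    by apply: measurable_funPTI; apply: measurableC; exact: measurable_itv.
  by rewrite /B U_unif ?uniform_outside//; apply: measurableC; exact: measurable_itv.
have [mE E0] : measurable (\big[setU/set0]_(p | p.1 != p.2) E p) /\
    P (\big[setU/set0]_(p | p.1 != p.2) E p) = 0%E.
  by apply: null_bigsetU => p pp; [exact: measurable_tie|exact: uniform_tie].
apply: (subset_measure0 (B := (\big[setU/set0]_i B i) `|`
                         (\big[setU/set0]_(p | p.1 != p.2) E p))).
- rewrite [X in measurable X](_ : _ =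
    random_vector (fun i => normal_score (U i)) @^-1`
    (~` [set t | uniq t])).
    by apply: measurable_funPTI; apply: measurableC; exact: measurable_uniq.
  by apply/seteqP; split => w /= /negP.
- exact: measurableU.
- move=> w /negP nu; have /existsNP[i /existsNP[j]] :
      ~ injective (tnth (random_vector (fun i => normal_score (U i)) w)).
    by move=> /tuple_uniqP.

  rewrite tnth_random_vector => /not_implyP[/eqP + /eqP ij].
  rewrite eqr_opp => /eqP Gij.
  have [Ui|Ui] := boolP (0 < U i w < 1); last first.
    left; rewrite -bigcup_seq; exists i; rewrite /B /= ?mem_index_enum//.
    by rewrite in_itv/=; exact/negP.
  have [Uj|Uj] := boolP (0 < U j w < 1); last first.
    left; rewrite -bigcup_seq; exists j; rewrite /B /= ?mem_index_enum//.
    by rewrite in_itv/=; exact/negP.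
  right; rewrite -bigcup_seq_cond; exists (i, j); rewrite /= ?mem_index_enum//.
  by rewrite /E /= -(Phi_oppG Ui) Gij Phi_oppG.
- exact: (etrans (measureU0 mB mE E0) B0).
Qed.

End ties.

(** * Order statistics *)

Section order_statistics.
Context {R : realType} {n : nat}.
Implicit Types (x : 'I_n -> R) (k : nat).

(** For the comparison table [D] of a vector, this lists the indices by increasing
    value.  It makes an order statistic a coordinate whose index depends only on
    finitely many comparisons ([ordstat_ranking]). *)
Definition ranking (D : 'I_n -> 'I_n -> bool) : seq 'I_n := sort D (enum 'I_n).

Lemma size_ranking D : size (ranking D) = n.
Proof. by rewrite size_sort size_enum_ord. Qed.

Lemma ordstat_ranking x k :
  ordstat x k = nth 0 [seq x i | i <- ranking (fun i j => x i <= x j)] k.-1.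
Proof. by rewrite /ordstat codomE sort_map. Qed.

Lemma ordstat_mono (f : R -> R) x k :
  (forall i j, (f (x i) <= f (x j)) = (x i <= x j)) -> (0 < k <= n)%N ->
  ordstat (fun i => f (x i)) k = f (ordstat x k).
Proof.
move=> fx /andP[k0 kn]; have kn' : (k.-1 < n)%N by rewrite prednK.
rewrite !ordstat_ranking.
have -> : (fun i j => f (x i) <= f (x j)) = (fun i j => x i <= x j).
  by apply/funext => i; apply/funext => j /=; rewrite fx.
by rewrite !(nth_map (Ordinal kn')) ?size_ranking.
Qed.

Lemma ordstat_perm x (p : {perm 'I_n}) k :
  ordstat (fun i => x (p i)) k = ordstat x k.
Proof.
rewrite /ordstat; congr nth; apply/perm_sort_leP.
rewrite !codomE (map_comp x p) perm_map//.
apply: uniq_perm; rewrite ?(map_inj_uniq perm_inj) ?enum_uniq// => i.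
rewrite mem_enum inE; apply/mapP; exists (p^-1%g i); first by rewrite mem_enum.
by rewrite permKV.
Qed.

Lemma ordstat_codom x k : (0 < k <= n)%N -> exists i, x i = ordstat x k.
Proof.
move=> /andP[k0 kn].
have : ordstat x k \in codom x.
  by rewrite -(mem_sort <=%O) mem_nth// size_sort size_codom card_ord prednK.
by case/codomP => i ->; exists i.
Qed.

Lemma ordstat_inj x k l : injective x -> (0 < k <= n)%N -> (0 < l <= n)%N ->
  ordstat x k = ordstat x l -> k = l.
Proof.
move=> /injectiveP xi /andP[k0 kn] /andP[l0 ln] /eqP.
rewrite nth_uniq ?sort_uniq// ?size_sort ?size_codom ?card_ord ?prednK//.
by move=> /eqP kl; rewrite -(prednK k0) kl prednK.
Qed.

End order_statistics.

Section finite_valued.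
Context d (T : measurableType d).

Lemma measurable_ffun_bool (I : finType) (b : T -> I -> bool) (y : {ffun I -> bool}) :
  (forall i, measurable_fun setT (b^~ i)) ->
  measurable ((fun w => [ffun i => b w i]) @^-1` [set y]).
Proof.
move=> mb; rewrite [X in measurable X](_ : _ = [set w | forall i, b w i = y i]).
  apply: measurable_forall => i; rewrite -[X in measurable X]setTI.
  exact: (mb i measurableT [set y i]).
apply/seteqP; split => w /=; first by move=> <- i; rewrite ffunE.
by move=> bw; apply/ffunP => i; rewrite ffunE.
Qed.

Lemma measurable_fun_piecewise d' (T' : measurableType d') (F : finType)
    (f : T -> F) (g : F -> T -> T') :
  (forall y, measurable (f @^-1` [set y])) ->
  (forall y, measurable_fun setT (g y)) ->
  measurable_fun setT (fun w => g (f w) w).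
Proof.
move=> mf mg _ A mA; rewrite setTI.
rewrite [X in measurable X](_ : _ =
    \big[setU/set0]_(y : F) (f @^-1` [set y] `&` g y @^-1` A)).
  apply: bigsetU_measurable => y _; apply: measurableI => //.
  by rewrite -[X in measurable X]setTI; exact: mg.
rewrite -bigcup_seq; apply/seteqP; split => w /=.
  by move=> Aw; exists (f w) => //=; rewrite mem_index_enum.
by move=> [y _ [/= <-]].
Qed.

Lemma measurable_fibers_comp (F F' : finType) (f : T -> F) (h : F -> F') (y : F') :
  (forall y, measurable (f @^-1` [set y])) ->
  measurable ((h \o f) @^-1` [set y]).
Proof.
move=> mf; rewrite [X in measurable X](_ : _ =
    \big[setU/set0]_(z : F | h z == y) f @^-1` [set z]).
  by apply: bigsetU_measurable.
rewrite -bigcup_seq_cond; apply/seteqP; split => w /=.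
  by move=> hy; exists (f w) => //=; rewrite mem_index_enum hy/=.
by move=> [z /= /andP[_ /eqP <-] ->].
Qed.

Lemma prob_fibers (R : realType) (P : probability T R) (F : finType) (f : T -> F)
    (A : set T) :
  (forall y, measurable (f @^-1` [set y])) -> measurable A ->
  (P A = \sum_(y : F) P (A `&` f @^-1` [set y]))%E.
Proof.
move=> mf mA.
suff H (r : seq F) : uniq r -> measurable (\bigcup_(y in [set` r]) f @^-1` [set y]) /\
    (P (A `&` \bigcup_(y in [set` r]) f @^-1` [set y]) =
     \sum_(y <- r) P (A `&` f @^-1` [set y]))%E.
  rewrite -(H _ (index_enum_uniq F)).2; congr (P _).
  apply/seteqP; split => w; last by case.
  by move=> Aw; split => //; exists (f w) => //=; rewrite mem_index_enum.
elim: r => [_|y r ih /= /andP[yr /ih[mr Pr]]].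
  by rewrite set_nil bigcup_set0 setI0 measure0 big_nil.
have -> : [set` y :: r] = y |` [set` r].
  apply/seteqP; split => z /=; rewrite inE; first by case/predU1P => [->|]; [left|right].
  by move=> [->|->]; rewrite ?eqxx ?orbT.
rewrite bigcup_setU1; split; first exact: measurableU.
rewrite big_cons -Pr setIUr measureU//; try exact: measurableI.
apply/seteqP; split => // w [[_ /= fy] [_ [z /= zr fz]]].
by move: yr; rewrite -fy fz zr.
Qed.

End finite_valued.

Section order_statistics_measurable.
Context {R : realType} {d} {T : measurableType d} {n : nat}.
Variable x : 'I_n -> T -> R.
Hypothesis mx : forall i, measurable_fun setT (x i).

(** On each event that fixes all comparisons [x i <= x j], an order
    statistic is a fixed coordinate, or the default value 0 out of range. *)
Lemma measurable_ordstat k : measurable_fun setT (fun w => ordstat (x^~ w) k).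
Proof.
pose D w := [ffun p : 'I_n * 'I_n => x p.1 w <= x p.2 w].
pose g (D : {ffun 'I_n * 'I_n -> bool}) w :=
  nth 0 [seq x i w | i <- ranking (fun i j => D (i, j))] k.-1.
rewrite (_ : (fun w => _) = (fun w => g (D w) w)).
  apply: measurable_fun_piecewise => [y|y].
    by apply: measurable_ffun_bool => p; exact: measurable_fun_ler.
  rewrite /g; elim: (ranking _) (k.-1) => [|i r ih] [|l] //=; exact: measurable_cst.
apply/funext => w; rewrite ordstat_ranking /g; congr (nth 0 [seq _ | i <- ranking _]).
by apply/funext => i; apply/funext => j /=; rewrite ffunE.
Qed.

(** The configuration depends only on which coordinates equal the order
    statistic. *)
Lemma measurable_config_at_rank N (s : 'I_n -> config N) k c :
  measurable ((fun w => config_at_rank s (x^~ w) k) @^-1` [set c]).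
Proof.
pose b w i := x i w == ordstat (x^~ w) k.
pose h (y : {ffun 'I_n -> bool}) : config N :=
  if [pick i | y i] is Some i then s i else point.
rewrite (_ : (fun w => _) = h \o (fun w => [ffun i => b w i])).
  apply: measurable_fibers_comp => y; apply: measurable_ffun_bool => i.
  by apply: measurable_fun_eqr => //; exact: measurable_ordstat.
apply/funext => w; rewrite /h /config_at_rank /=.
by under [in RHS]eq_pick do rewrite ffunE.
Qed.

End order_statistics_measurable.

(** * Configurations carrying the smallest values of an exchangeable vector *)

(** The symmetric group is [#|C|]-transitive, hence [K]-transitive. *)
Lemma perm_of_uniq_tuples (C : finType) (K : nat) (c c' : K.-tuple C) :
  uniq c -> uniq c' -> exists tau : {perm C}, map tau c = c'.
Proof.
move=> cu c'u.
have KC : (K <= #|C|)%N.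
  by rewrite -(size_tuple c) -(card_uniqP cu) max_card.
have du (b : K.-tuple C) : uniq b -> b \in K.-dtuple([set: C]%SET).
  by move=> bu; rewrite inE bu /=; apply/fintype.subsetP => z _; rewrite finset.in_setT.
have [tau _ ->] := atransP2 (ntransitive_weak KC (Sym_trans C)) (du _ cu) (du _ c'u).
by exists tau.
Qed.

(** The probability that [size s] successive uniform draws without replacement
    from [C] produce [s]. *)
Definition draw_prob (R : realType) (C : finType) (s : seq C) : R :=
  if uniq s then (#|C| ^_ (size s))%:R^-1 else 0.

Section leading_configurations.
Context {R : realType} {N : nat}.
Local Notation n := (2 ^ N)%N.
Variables (K : nat) (s : 'I_n -> config N).
Hypothesis (s_bij : bijective s) (K_le : (K <= n)%N).
Implicit Types (x : 'I_n -> R).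

Definition leading_configs x : K.-tuple (config N) :=
  [tuple config_at_rank s x k.+1 | k < K].

Lemma config_at_rankE x i k : injective x -> x i = ordstat x k ->
  config_at_rank s x k = s i.
Proof.
move=> xi xk; rewrite /config_at_rank; case: pickP => [j|/(_ i)].
  by rewrite -xk => /eqP/xi ->.
by rewrite xk eqxx.
Qed.

Lemma rank_in (k : 'I_K) : (0 < k.+1 <= n)%N.
Proof. exact: leq_trans (ltn_ord k) K_le. Qed.

Lemma leading_configs_uniq x : injective x -> uniq (leading_configs x).
Proof.
move=> xi; apply/tuple_uniqP => k l; rewrite !tnth_mktuple.
have [i xk] := ordstat_codom x (rank_in k).
have [j xl] := ordstat_codom x (rank_in l).
rewrite (config_at_rankE xi xk) (config_at_rankE xi xl) => /(bij_inj s_bij) ij.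
by have /(ordstat_inj xi (rank_in k) (rank_in l))[/val_inj] :
  ordstat x k.+1 = ordstat x l.+1 by rewrite -xk -xl ij.
Qed.

(** If [x (p i)] has rank [k] among the permuted values, then [x] has at rank [k]
    the index [p i], which carries [s (p i) = tau (s i)]. *)
Lemma leading_configs_perm x (p : {perm 'I_n}) (tau : config N -> config N) :
  injective x -> (forall i, s (p i) = tau (s i)) ->
  map tau (leading_configs (fun i => x (p i))) = leading_configs x.
Proof.
move=> xi sp; rewrite -map_comp; apply: eq_map => k /=.
have [i xk] := ordstat_codom x (rank_in k).
rewrite (config_at_rankE xi xk) (@config_at_rankE _ (p^-1%g i)).
- by rewrite -sp permKV.
- by move=> a b /xi/perm_inj.
- by rewrite permKV ordstat_perm.
Qed.

Definition permute_tuple (p : {perm 'I_n}) (t : n.-tuple R) : n.-tuple R :=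
  [tuple tnth t (p i) | i < n].

Lemma tnth_permute_tuple p t : tnth (permute_tuple p t) = fun i => tnth t (p i).
Proof. by apply/funext => i; rewrite tnth_mktuple. Qed.

Lemma measurable_permute_tuple p : measurable_fun setT (permute_tuple p).
Proof.
apply/measurable_fun_tnthP => i.
rewrite (_ : _ \o _ = (@tnth n R)^~ (p i)); first exact: measurable_tnth.
by apply/funext => t /=; rewrite tnth_mktuple.
Qed.

Definition leading_event (c : K.-tuple (config N)) : set (n.-tuple R) :=
  (fun t => leading_configs (tnth t)) @^-1` [set c].

Lemma measurable_leading_event c : measurable (leading_event c).
Proof.
rewrite [X in measurable X](_ : _ = [set t | forall k : 'I_K,
    ((fun t => config_at_rank s (tnth t) k.+1) @^-1` [set tnth c k]) t]).
  apply: measurable_forall => k.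
  apply: (@measurable_config_at_rank _ _ _ _ (fun i t => tnth t i)) => i.
  exact: measurable_tnth.
apply/seteqP; split => t /=; first by move=> <- k; rewrite tnth_mktuple.
by move=> tc; apply: eq_from_tnth => k; rewrite tnth_mktuple tc.
Qed.

Variable Q : probability (n.-tuple R) R.
Hypothesis Q_exch : forall (p : {perm 'I_n}) B, measurable B ->
  Q (permute_tuple p @^-1` B) = Q B.
Hypothesis Q_uniq : Q [set t : n.-tuple R | ~~ uniq t] = 0%E.

Lemma measurable_not_uniq : measurable [set t : n.-tuple R | ~~ uniq t].
Proof.
rewrite [X in measurable X](_ : _ = ~` [set t : n.-tuple R | uniq t]).
  by apply: measurableC; exact: measurable_uniq.
by apply/seteqP; split => t /= /negP.
Qed.

Variable B : set (n.-tuple R).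
Hypothesis mB : measurable B.
Hypothesis B_sym : forall p t, B (permute_tuple p t) <-> B t.

(** A permutation [tau] of the configurations with [map tau c = c'], conjugated by
    [s], permutes the coordinates; it preserves [Q] and [B], and off the ties it
    exchanges the two events. *)
Lemma leading_event_uniform (c c' : K.-tuple (config N)) : uniq c -> uniq c' ->
  Q (B `&` leading_event c) = Q (B `&` leading_event c').
Proof.
move=> cu c'u; have [tau tc] := perm_of_uniq_tuples cu c'u.
have [g sK gK] := s_bij.
have pi : injective (fun i => g (tau (s i))).
  by move=> i j /(can_inj gK)/perm_inj/(can_inj sK).
pose p := perm pi.
have sp i : s (p i) = tau (s i) by rewrite permE gK.
have mE c0 : measurable (B `&` leading_event c0).
  by apply: measurableI => //; exact: measurable_leading_event.
rewrite -(Q_exch p)//.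
apply: (eq_prob_off_null measurable_not_uniq _ _ Q_uniq) => //.
  by rewrite -[X in measurable X]setTI; exact: measurable_permute_tuple.
move=> t /negP; rewrite negbK => /tuple_uniqP ti.
rewrite /leading_event /= tnth_permute_tuple.
split => -[Bt tE]; split; first exact: (B_sym p t).1.
- by apply: val_inj; rewrite /= -(leading_configs_perm ti sp) tE.
- exact: (B_sym p t).2.
- apply: val_inj; apply: (inj_map (@perm_inj _ tau)).
  by rewrite /= (leading_configs_perm ti sp) tE.
Qed.

(** The events [leading_event c], for [c] without repetition, partition the space
    up to ties, and there are [n ^_ K] of them with equal probabilities. *)
Lemma leading_event_prob (c : K.-tuple (config N)) :
  Q (B `&` leading_event c) = ((draw_prob R c)%:E * Q B)%E.
Proof.
rewrite /draw_prob size_tuple; case: ifPn => cu; last first.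
  rewrite mul0e; apply: (subset_measure0 _ _ _ Q_uniq).
  - by apply: measurableI => //; exact: measurable_leading_event.
  - exact: measurable_not_uniq.
  - move=> t [_ tc]; apply/negP => /tuple_uniqP/leading_configs_uniq.
    by rewrite tc; apply/negP.
have /bij_eq_card := s_bij; rewrite card_ord => <-.
pose q := Q (B `&` leading_event c).
have qE : q \is a fin_num.
  apply: fin_num_measure; apply: measurableI => //; exact: measurable_leading_event.
have nK0 : (n ^_ K)%:R != 0 :> R by rewrite pnatr_eq0 -lt0n ffact_gt0.
suff -> : Q B = ((n ^_ K)%:R%:E * q)%E.
  by rewrite muleA -EFinM mulVf// mul1e.
rewrite (prob_fibers Q measurable_leading_event mB).
rewrite (bigID (fun c : K.-tuple _ => uniq c))/=.
rewrite [X in (_ + X)%E]big1 ?adde0; last first.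
  move=> c0 c0u; apply: (subset_measure0 _ _ _ Q_uniq).
  - by apply: measurableI => //; exact: measurable_leading_event.
  - exact: measurable_not_uniq.
  - move=> t [_ tc]; apply/negP => /tuple_uniqP/leading_configs_uniq.
    by rewrite tc; apply/negP.
rewrite (eq_bigr (fun=> q)); last by move=> c0 c0u; exact: leading_event_uniform.
rewrite -(fineK qE) sumEFin -EFinM sumr_const mulr_natl; congr (_ *+ _)%:E.
have := @card_uniq_tuples (config N) K predT.
have /bij_eq_card := s_bij; rewrite card_ord => <- <-.
rewrite cardsE; apply: eq_card => c0; rewrite !unfold_in.
by rewrite all_predT.
Qed.

End leading_configurations.

(** * Draws without replacement *)

(** The conditional probabilities given by the successive draws multiply up:
    [n ^_ m.+1 = n ^_ m * (n - m)]. *)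
Lemma draws_prefix_prob d (T : measurableType d) (R : realType) (P : probability T R)
    (C : finType) (K : nat) (sigma : T -> K.-tuple C) :
  draws_without_replacement P sigma ->
  forall r : seq C, (size r <= K)%N ->
  P [set w | take (size r) (sigma w) = r] = (draw_prob R r)%:E.
Proof.
move=> draws; elim/last_ind => [_|r t ih].
  rewrite [X in P X](_ : _ = setT).
    by rewrite probability_setT /draw_prob /= ffactn0 invr1.
  by apply/seteqP; split => // w _ /=; rewrite take0.
rewrite size_rcons => rK; rewrite draws// ih 1?ltnW// -EFinM; congr _%:E.
rewrite /draw_prob rcons_uniq size_rcons ffactnSr natrM invfM.
by case: (t \in r); case: (uniq r); rewrite /= ?(mulr0, mul0r).
Qed.

Lemma draws_prob d (T : measurableType d) (R : realType) (P : probability T R)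
    (C : finType) (K : nat) (sigma : T -> K.-tuple C) (c : K.-tuple C) :
  draws_without_replacement P sigma ->
  P (sigma @^-1` [set c]) = (draw_prob R c)%:E.
Proof.
move=> /draws_prefix_prob <-; last by rewrite size_tuple.
congr (P _); apply/seteqP; split => w /=; rewrite size_tuple.
  by move=> <-; rewrite take_oversize// size_tuple.
by rewrite take_oversize ?size_tuple// => /val_inj.
Qed.

Lemma measurable_tuple_set1 (N K : nat) (c : K.-tuple (config N)) :
  measurable [set c].
Proof.
rewrite [X in measurable X](_ : _ =
    [set t : K.-tuple (config N) | forall i, (tnth t i) = tnth c i]).
  apply: measurable_forall => i.
  rewrite -[X in measurable X]setTI.
  exact: (measurable_tnth i measurableT (Y := [set tnth c i])).
by apply/seteqP; split => t /=; [move=> -> | move=> tc; exact: eq_from_tnth].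
Qed.

(** * The weighted random measure *)

Section weighted_measure.
Context {R : realType}.
Variables (beta : R) (N K : nat).
Implicit Types (c : K.-tuple (config N)) (h : nat -> R).

Definition weighted_functional c h (Psi : config N -> R) : R :=
  (\sum_(1 <= k < K.+1) Psi (nth point c k.-1) * gibbs_weight beta N (h k - h 1%N))
  / (\sum_(1 <= k < K.+1) gibbs_weight beta N (h k - h 1%N)).

Definition weighted_measure c h : pprobability (config N) R :=
  measure_of (weighted_functional c h).

Lemma mu_weighted (s : 'I_(2 ^ N) -> config N) (x : 'I_(2 ^ N) -> R) :
  mu beta K s x = weighted_measure (leading_configs K s x) (ordstat x).
Proof.
congr (measure_of _); apply/funext => Psi; congr (_ / _).
apply: eq_big_nat => k /andP[k0 kK]; congr (Psi _ * _).
have kK' : (k.-1 < K)%N by rewrite prednK.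
by rewrite -[k.-1]/(val (Ordinal kK')) -tnth_nth tnth_mktuple /= prednK.
Qed.

Lemma eq_weighted_measure c h h' :
  (forall k, (0 < k <= K)%N -> h k = h' k) ->
  weighted_measure c h = weighted_measure c h'.
Proof.
move=> hh'; congr (measure_of _); apply/funext => Psi.
by congr (_ / _); apply: eq_big_nat => k kK; have /andP[k0 kK'] := kK;
  rewrite !hh' //= (leq_trans k0 kK').
Qed.

Hypothesis K_gt0 : (0 < K)%N.

Lemma mu_tilde_weighted c (u : 'I_(2 ^ N) -> R) :
  mu_tilde beta c u = weighted_measure c (fun k => - G (ordstat u k)).
Proof.
congr (measure_of _); apply/funext => Psi.
have wE k : gibbs_weight beta N (G (ordstat u 1) - G (ordstat u k)) =
    gibbs_weight beta N (- G (ordstat u k) - - G (ordstat u 1)).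
  by rewrite opprK addrC.
rewrite /mu_tilde_functional /weighted_functional.
rewrite [in RHS]big_ltn// [X in _ = _ / X]big_ltn//.
rewrite subrr /gibbs_weight mulr0 oppr0 expR0 mulr1 -/(gibbs_weight _ _ _).
by congr ((_ + _) / (_ + _)); apply: eq_bigr => k _; rewrite -/(gibbs_weight _ _ _) wE.
Qed.

Lemma weighted_measureE c h (A : set (config N)) :
  weighted_measure c h A = (weighted_functional c h \1_A)%:E.
Proof.
have rep : represents (weighted_functional c h) (weighted_measure c h).
  by apply: xgetPex; apply: represents_weighted => // k; exact: expR_gt0.
by rewrite -rep integral_indic// setIT.
Qed.

(** The sigma-algebra on probability measures is generated by the evaluations, and
    the evaluation at a set is a quotient of finite sums of measurable weights. *)
Lemma measurable_weighted_measure d (T : measurableType d) c (h : nat -> T -> R) :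
  (forall k, measurable_fun setT (h k)) ->
  measurable_fun setT (fun w => weighted_measure c (h^~ w)).
Proof.
move=> mh.
have mw k : measurable_fun setT (fun w => gibbs_weight beta N (h k w - h 1%N w)).
  rewrite /gibbs_weight.
  apply: (measurableT_comp (@measurable_expR R)); apply: measurable_funN.
  by apply: measurable_funM => //; exact: measurable_funB.
apply: (measurability (@pset _ _ _ : set (set (pprobability _ R)))) => //.
move=> _ -[_ [r r01] [Ys mYs <-]] <-; apply: emeasurable_fun_infty_o => //=.
under eq_fun do rewrite weighted_measureE.
apply/measurable_EFinP; apply: measurable_funM.
  by apply: measurable_sum => k; exact: measurable_funM.
pose D w := \sum_(1 <= k < K.+1) gibbs_weight beta N (h k w - h 1%N w).
have D0 w : 0 < D w.
  rewrite /D big_ltn// ltr_pwDl ?expR_gt0// sumr_ge0// => k _; exact: expR_ge0.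
(* The inverse of a positive number [y] is [expR (- ln y)]. *)
rewrite (_ : (fun w => _) = expR \o (-%R \o (@ln R \o D))).
  apply: measurableT_comp => //; apply: measurableT_comp => //.
  apply: measurableT_comp; first exact: measurable_ln.
  exact: measurable_sum.
by apply/funext => w /=; rewrite expRN lnK// posrE.
Qed.

End weighted_measure.

(** * Equality of the laws *)

Lemma ordstat_oppG (R : realType) (n : nat) (u : 'I_n -> R) (k : nat) :
  (forall i, 0 < u i < 1) -> (0 < k <= n)%N ->
  - G (ordstat u k) = ordstat (fun i => - G (u i)) k.
Proof.
move=> u01 kn; rewrite (ordstat_mono (f := fun v => - G v))// => i j.
by rewrite oppG_le// Phi_oppG.
Qed.

Theorem claim1 (R : realType) (beta : R) (k : nat -> nat)
  (beta_gt : beta_c R < beta)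
  (k_range : forall N : nat, (0 < N)%N -> (0 < k N <= 2 ^ N)%N)
  (k_infty : increases_to_pinfty (fun N : nat => (k N)%:R : R))
  (k_over_N : increases_to_pinfty (fun N : nat => (k N)%:R / N%:R : R))
  (logk_over_N : decreases_to_0 (fun N : nat => ln (k N)%:R / N%:R : R))
  (N : nat) (N_gt0 : (0 < N)%N)
  (s : 'I_(2 ^ N) -> config N) (s_enum : bijective s)
  (d1 : measure_display) (T1 : measurableType d1) (P1 : probability T1 R)
  (X : 'I_(2 ^ N) -> {RV P1 >-> R})
  (X_indep : mutually_independent P1 X)
  (X_gauss : forall i, has_law P1 (X i) (normal_prob 0 1))
  (d2 : measure_display) (T2 : measurableType d2) (P2 : probability T2 R)
  (U : 'I_(2 ^ N) -> {RV P2 >-> R})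
  (U_indep : mutually_independent P2 U)
  (U_unif : forall i, has_law P2 (U i) (uniform_prob (@ltr01 R)))
  (sigma : {RV P2 >-> (k N).-tuple (config N)})
  (sigma_draws : draws_without_replacement P2 sigma)
  (U_sigma_indep :
    independent P2 (fun w => [tuple U i w | i < 2 ^ N]) sigma) :
  same_law P2 P1
    (fun w => mu_tilde beta (sigma w) (fun i => U i w))
    (fun w => mu beta (k N) s (fun i => X i w)).
Proof.
have /andP[K0 Kn] := k_range N N_gt0.
have mset1 (c : (k N).-tuple (config N)) : measurable (sigma @^-1` [set c]).
  by apply: measurable_funPTI; exact: measurable_tuple_set1.
pose Z i := normal_score (U i).
have mZ i A : measurable A -> P2 (Z i @^-1` A) = normal_prob 0 1 A.
  by move=> mA; exact: normal_score_law.
have Z_indep : mutually_independent P2 Z.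
  apply: (independent_comp (f := fun u => - G u)) => //.
  by apply: measurable_funN; exact: measurable_G.
pose Q := distribution P1 (random_vector X).
have QZ B : measurable B -> Q B = P2 (random_vector Z @^-1` B).
  move=> mB; apply: (eq_law_independent X_indep Z_indep) => // i A mA.
  by rewrite mZ// X_gauss.
have Q_exch (p : {perm 'I_(2 ^ N)}) B :
    measurable B -> Q (permute_tuple p @^-1` B) = Q B.
  move=> mB; have Xp := independent_perm p X_indep.
  rewrite -[RHS](eq_law_independent Xp X_indep)//; last first.
    by move=> i A mA; rewrite !X_gauss.
  congr (P1 _); apply/seteqP.
  by split => w /=; rewrite /permute_tuple tnth_random_vector.
have Q_uniq : Q [set t : (2 ^ N).-tuple R | ~~ uniq t] = 0%E.
  by rewrite QZ; [exact: normal_score_uniq | exact: measurable_not_uniq].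
pose W (c : (k N).-tuple (config N)) (x : 'I_(2 ^ N) -> R) :=
  weighted_measure beta c (ordstat x).
have mW d (T : measurableType d) c (x : 'I_(2 ^ N) -> T -> R) :
    (forall i, measurable_fun setT (x i)) -> measurable_fun setT (fun w => W c (x^~ w)).
  move=> mx; apply: (@measurable_weighted_measure R beta N (k N) K0 _ T c
    (fun l w => ordstat (x^~ w) l)) => l.
  exact: measurable_ordstat.
have mWG d (T : measurableType d) (c : (k N).-tuple (config N))
    (x : 'I_(2 ^ N) -> T -> R) :
    (forall i, measurable_fun setT (x i)) ->
    measurable_fun setT
      (fun w => weighted_measure beta c (fun l => - G (ordstat (x^~ w) l))).
  move=> mx; apply: (@measurable_weighted_measure R beta N (k N) K0 _ T c
    (fun l w => - G (ordstat (x^~ w) l))) => l.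
  apply: measurable_funN; apply: measurableT_comp; first exact: measurable_G.
  exact: measurable_ordstat.
have mlead c : measurable ((fun w => leading_configs (k N) s (X^~ w)) @^-1` [set c]).
  have := measurable_funPTI (random_vector X) (measurable_leading_event s c).
  congr measurable; apply/seteqP.
  by split => w; rewrite /leading_event /= tnth_random_vector.
have m1 : measurable_fun setT (fun w => mu beta (k N) s (X^~ w)).
  under eq_fun do rewrite mu_weighted.
  apply: (measurable_fun_piecewise mlead (g := fun c w => W c (X^~ w))) => c.
  by apply: mW => i; exact: measurable_funP.
have m2 : measurable_fun setT (fun w => mu_tilde beta (sigma w) (U^~ w)).
  under eq_fun do rewrite mu_tilde_weighted//.
  apply: (measurable_fun_piecewise mset1
    (g := fun c w => weighted_measure beta c (fun l => - G (ordstat (U^~ w) l)))) => c.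
  by apply: mWG => i; exact: measurable_funP.
split => // A mA.
pose B c := [set t : (2 ^ N).-tuple R | A (W c (tnth t))].
have mB c : measurable (B c).
  rewrite -[X in measurable X]setTI.
  apply: (mW _ _ c (fun i t => tnth t i)) => // i; exact: measurable_tnth.
pose B' (c : (k N).-tuple (config N)) := [set t : (2 ^ N).-tuple R |
  A (weighted_measure beta c (fun l => - G (ordstat (tnth t) l)))].
have mB' c : measurable (B' c).
  rewrite -[X in measurable X]setTI.
  apply: (mWG _ _ c (fun i t => tnth t i)) => // i; exact: measurable_tnth.
(* Both probabilities are split according to the tuple [c] of configurations. *)
transitivity (\sum_(c : (k N).-tuple (config N)) (draw_prob R c)%:E * Q (B c))%E.
  rewrite (prob_fibers P2 mset1); last by rewrite -[X in measurable X]setTI; exact: m2.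
  apply: eq_bigr => c _.
  transitivity (P2 (random_vector U @^-1` B' c `&` sigma @^-1` [set c])).
    congr (P2 _); apply/seteqP.
    by split => w [/= + sc]; rewrite sc mu_tilde_weighted// /B' /= tnth_random_vector.
  rewrite (U_sigma_indep _ _ (mB' c) (measurable_tuple_set1 c)).
  rewrite draws_prob// muleC; congr (_ * _)%E; rewrite QZ//.
  (* Off the null event that some [U i] leaves (0, 1), the order statistics of the
     scores are the images of those of the [U i]. *)
  pose out i := U i @^-1` (~` `]0, 1[%classic).
  have mout i : measurable (out i).
    by apply: measurable_funPTI; apply: measurableC; exact: measurable_itv.
  have [||mO O0] := @null_bigsetU _ _ _ P2 _ out predT; first by [].
    move=> i _; rewrite /out U_unif ?uniform_outside//.
    by apply: measurableC; exact: measurable_itv.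
  apply: (eq_prob_off_null mO _ _ O0).
  - exact: (measurable_funPTI (random_vector U) (mB' c)).
  - exact: (measurable_funPTI (random_vector Z) (mB c)).
  move=> w nO.
  have U01 i : 0 < U i w < 1.
    apply/negP => /negP Ui; apply: nO; rewrite -bigcup_seq.
    by exists i; rewrite /out /= ?mem_index_enum// in_itv/=; exact/negP.
  rewrite /B /B' /= !tnth_random_vector.
  have Wh := @eq_weighted_measure R beta N (k N) c (fun l => - G (ordstat (U^~ w) l))
    (ordstat (Z^~ w)).
  rewrite Wh// => l /andP[l0 lK].
  by rewrite ordstat_oppG// l0 (leq_trans lK).
rewrite (prob_fibers P1 mlead); last by rewrite -[X in measurable X]setTI; exact: m1.
apply: eq_bigr => c _.
rewrite -(leading_event_prob s_enum Kn Q_exch Q_uniq (mB c)).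
  rewrite /Q /distribution /pushforward; congr (P1 _); apply/seteqP.
  by split => w [/=]; rewrite /B /leading_event /= !tnth_random_vector => + sc;
    rewrite mu_weighted sc.
move=> p t; rewrite /B /= tnth_permute_tuple /W.
rewrite (_ : ordstat (fun i => tnth t (p i)) = ordstat (tnth t))//.
by apply/funext => l; exact: ordstat_perm.
Qed.
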